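(* Let $I$ be any instance of Max KP, with item set $A=\{a_1,\ldots,a_n\}$, sizes $s_1,\ldots,s_n$ and capacity $c$. The following conditions are equivalent: (1) $I$ has an equivalent graph; (2) $I$ satisfies property $P(I)$; (3) $I$ is equivalent to the graph $G(I)$; (4) $I$ has an equivalent threshold graph.
   Context: Max KP: an instance consists of a set $A=\{a_1,\ldots,a_n\}$ of $n$ items, where item $a_j$ has a non-negative real size $s_j$ and a non-negative real profit $p_j$, and a non-negative real capacity $c$. The task is to find $A'\subseteq A$ with $\sum_{a_j\in A'}s_j\le c$ that maximizes $\sum_{a_j\in A'}p_j$. A subset $A'\subseteq A$ with $\sum_{a_j\in A'}s_j\le c$ is a feasible solution. A Max KP instance $I$ and a finite simple undirected graph $G=(V,E)$ are equivalent if there is a bijection $f:A\to V$ such that, for every $A'\subseteq A$, $A'$ is a feasible solution of $I$ if and only if $f(A')=\{f(a_j): a_j\in A'\}$ is an independent set of $G$. Property $P(I)$: for every $A'\subseteq A$, if $s_j+s_{j'}\le c$ for all distinct $a_j,a_{j'}\in A'$, then $\sum_{a_j\in A'}s_j\le c$. The graph $G(I)$ has vertex set $\{v_j : a_j\in A\}$ and edge set $\{\{v_j,v_{j'}\}: j\ne j',\ s_j+s_{j'}>c\}$. A graph $G=(V,E)$ is a threshold graph if there exist non-negative reals $w_v$ ($v\in V$) and $T$ such that for every $U\subseteq V$ one has $\sum_{v\in U}w_v\le T$ if and only if $U$ is an independent set of $G$. Equivalently, $G$ contains none of $C_4$, $P_4$, $2K_2$ as an induced subgraph. *)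

(* Defs.v *)
From mathcomp Require Export all_boot all_order all_algebra.
From mathcomp Require Export reals.

Set Implicit Arguments.
Unset Strict Implicit.
Unset Printing Implicit Defensive.

Import Order.TTheory GRing.Theory Num.Theory.
Local Open Scope ring_scope.

Record max_kp (R : realType) := MaxKP {
  items : nat;
  item_size : 'I_items -> R;
  item_profit : 'I_items -> R;
  capacity : R;
  item_size_ge0 : forall j, 0 <= item_size j;
  item_profit_ge0 : forall j, 0 <= item_profit j;
  capacity_ge0 : 0 <= capacity }.

Record sgraph := SGraph {
  vertex :> finType;
  adj : rel vertex;
  adj_sym : symmetric adj;
  adj_irr : irreflexive adj }.

Definition independent (G : sgraph) (U : {set G}) : bool :=
  [forall u in U, forall v in U, ~~ adj u v].

Definition feasible (R : realType) (I : max_kp R) (A' : {set 'I_(items I)}) : bool :=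
  \sum_(j in A') item_size j <= capacity I.

Definition kp_equiv (R : realType) (I : max_kp R) (G : sgraph) : Prop :=
  exists f : 'I_(items I) -> G,
    bijective f /\
    forall A' : {set 'I_(items I)}, feasible A' <-> independent (f @: A').

Definition property_P (R : realType) (I : max_kp R) : Prop :=
  forall A' : {set 'I_(items I)},
    (forall j j', j \in A' -> j' \in A' -> j != j' ->
       item_size j + item_size j' <= capacity I) ->
    \sum_(j in A') item_size j <= capacity I.

Definition kp_adj (R : realType) (I : max_kp R) : rel 'I_(items I) :=
  fun j j' => (j != j') && (capacity I < item_size j + item_size j').

Lemma kp_adj_sym (R : realType) (I : max_kp R) : symmetric (@kp_adj R I).
Proof. by move=> j j'; rewrite /kp_adj eq_sym addrC. Qed.

Lemma kp_adj_irr (R : realType) (I : max_kp R) : irreflexive (@kp_adj R I).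
Proof. by move=> j; rewrite /kp_adj eqxx. Qed.

(* The vertex v_j is represented by the index j itself. *)
Definition kp_graph (R : realType) (I : max_kp R) : sgraph :=
  SGraph (@kp_adj_sym R I) (@kp_adj_irr R I).

Definition threshold_graph (R : realType) (G : sgraph) : Prop :=
  exists (w : G -> R) (T : R),
    [/\ forall v, 0 <= w v,
        0 <= T
      & forall U : {set G}, \sum_(v in U) w v <= T <-> independent U].

(* Main.v *)
Require Import Defs.

Import Order.TTheory GRing.Theory Num.Theory.
Local Open Scope ring_scope.

(** Independence in a simple graph is decided by the two-element subsets, so
    feasibility in an instance equivalent to a graph is too; this is property P.
    Conversely any graph equivalent to the instance is a threshold graph, with
    the item sizes as weights and the capacity as threshold. *)

Lemma feasible_pair (R : realType) (I : max_kp R) (j j' : 'I_(items I)) :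
  j != j' ->
  feasible [set j; j'] = (item_size j + item_size j' <= capacity I).
Proof. by move=> neq; rewrite /feasible big_setU1 ?inE // big_set1. Qed.

Lemma feasibleS (R : realType) (I : max_kp R) (A B : {set 'I_(items I)}) :
  A \subset B -> feasible B -> feasible A.
Proof.
move=> sAB; apply: le_trans; rewrite [leRHS](big_setID A) /= (setIidPr sAB).
by rewrite lerDl sumr_ge0 // => j _; apply: item_size_ge0.
Qed.

Lemma independentP (G : sgraph) (U : {set G}) :
  reflect {in U &, forall u v, ~~ adj u v} (independent U).
Proof.
apply: (iffP 'forall_in_forall_inP) => indU u.
  by move=> v uU vU; apply: indU.
by move=> uU v; apply: indU.
Qed.

Lemma kp_equiv_property_P (R : realType) (I : max_kp R) (G : sgraph) :
  kp_equiv I G -> property_P I.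
Proof.
move=> [f [_ fP]] A pairA; apply/fP/independentP.
move=> _ _ /imsetP[j jA ->] /imsetP[j' j'A ->].
(* [independent] also tests a vertex against itself, where irreflexivity settles it; distinct items
   form a pair that [pairA] makes feasible. *)
have [->|neq] := eqVneq j j'; first by rewrite adj_irr.
have /fP/independentP ind2 : feasible [set j; j'].
  by rewrite feasible_pair //; apply: pairA.
by apply: ind2; apply: imset_f; rewrite !inE eqxx ?orbT.
Qed.

(** The vertices are the items, so the identity serves as bijection. Shrinking a feasible set to a
    pair rules out edges; the other direction is property P itself. *)
Lemma property_P_kp_graph (R : realType) (I : max_kp R) :
  property_P I -> kp_equiv I (kp_graph I).
Proof.
move=> PI; exists id; split=> [|A]; first by exists id.
rewrite imset_id; split=> [feasA|/independentP indA].
  apply/independentP => j j' jA j'A; rewrite /= /kp_adj negb_and negbK.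
  have [//|neq] /= := eqVneq j j'.
  rewrite -leNgt -feasible_pair //; apply: feasibleS feasA.
  by rewrite subUset !sub1set jA.
apply: PI => j j' jA j'A neq.
by have := indA j j' jA j'A; rewrite /= /kp_adj neq -leNgt.
Qed.

Lemma kp_equiv_threshold (R : realType) (I : max_kp R) (G : sgraph) :
  kp_equiv I G -> threshold_graph R G.
Proof.
move=> [f [[g fK gK] fP]]; exists (fun v => item_size (g v)), (capacity I).
split=> [v||U]; [exact: item_size_ge0 | exact: capacity_ge0 |].
(* Every vertex set is the image of an item set, so [fP] reaches every [U]. *)
have fgU : f @: (g @: U) = U.
  by rewrite -imset_comp (eq_imset _ gK) imset_id.
rewrite -[in independent U]fgU -fP /feasible big_imset //.
by move=> u v _ _; apply: can_inj gK _ _.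
Qed.

Theorem theorem3p18 (R : realType) (I : max_kp R) :
  [<-> exists G : sgraph, kp_equiv I G;
       property_P I;
       kp_equiv I (kp_graph I);
       exists G : sgraph, threshold_graph R G /\ kp_equiv I G].
Proof.
tfae.
- by move=> [G]; apply: kp_equiv_property_P.
- exact: property_P_kp_graph.
(* G(I) itself is the threshold graph sought. *)
- by move=> IG; exists (kp_graph I); split=> //; apply: kp_equiv_threshold IG.
- by move=> [G [_ IG]]; exists G.
Qed.
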